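(* Let $J\in\{[0,\infty),\mathbb{R}\}$, let $X$ be a real Banach space and let $E=X\oplus iX$ be its complexification. Let $\mathfrak{g}(t)=e^{it^2}$ for $t\in\mathbb{R}$. (i) Let $\phi:J\to E$ be such that $(T\phi)(s,\cdot)\in UC(J,E)$ and $(\underline{T}\phi)(s,\cdot)\in UC(J,E)$ for each $s>0$. Then $\phi\in BUC(J,E)$. (ii) Let $\phi: J\to E$ be such that $(T\phi)(s,\cdot)\in C_0(J,E)$ for each $s>0$. Then $\phi\in (1/\mathfrak{g})\,\Delta C_0(J,E)$. (iii) Let $\xi:J\to E$ be such that $(T(\xi/\mathfrak{g}))(s,\cdot)\in UC(J,E)$ and $(\underline{T}(\mathfrak{g}\xi))(s,\cdot)\in UC(J,E)$ for each $s>0$. Then $\xi\in\Delta C_0(J,E)=\Delta C_0(J,X)+i\,\Delta C_0(J,X)$.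
   Context: $E=X\oplus iX$ is the complex linear space with multiplication $(a+ib)(y_1+iy_2)=(ay_1-by_2)+i(by_1+ay_2)$, endowed with the (product) topology of the norm $\|y_1+iy_2\|=\max\{\|y_1\|,\|y_2\|\}$ (or any of the equivalent norms $(\|y_1\|^p+\|y_2\|^p)^{1/p}$, $1\le p<\infty$). For $f:J\to E$ and $s>0$, $(\Delta_s f)(t)=f(t+s)-f(t)$. For $\phi:J\to E$ and $s,t\in J$, $$(T\phi)(s,t)=e^{i(s^2+2st)}\phi(s+t)-\phi(t)=\frac{1}{\mathfrak{g}(t)}\Delta_s(\mathfrak{g}\phi)(t),\qquad (\underline{T}\phi)(s,t)=e^{-i(s^2+2st)}\phi(s+t)-\phi(t)=\mathfrak{g}(t)\,\Delta_s(\phi/\mathfrak{g})(t).$$ For a Banach space $Y$: $UC(J,Y)$, $BUC(J,Y)$, $C_0(J,Y)$ denote the spaces of uniformly continuous (not necessarily bounded), bounded uniformly continuous, and continuous vanishing at infinity functions $J\to Y$; and $\Delta C_0(J,Y)=\{\phi\in L^1_{loc}(J,Y): \Delta_h\phi\in C_0(J,Y)\text{ for all }h>0\}$. $(1/\mathfrak{g})\mathcal{F}$ style products mean $(1/\mathfrak{g})\,\Delta C_0(J,E)=\{\xi/\mathfrak{g}:\xi\in\Delta C_0(J,E)\}$. *)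

(* Defs.v *)
From HB Require Import structures.
From mathcomp Require Import all_boot all_order all_algebra.
From mathcomp Require Import all_classical all_reals all_analysis.
From mathcomp Require Import complex ring.
Set Implicit Arguments.
Unset Strict Implicit.
Unset Printing Implicit Defensive.
Import Order.TTheory GRing.Theory Num.Theory.
Import numFieldNormedType.Exports.
Local Open Scope classical_set_scope.
Local Open Scope ring_scope.

(* The pair (y1, y2) stands for y1 + i y2.  Norm and topology are those of the
   product X * X, whose norm is max(`|y1|, `|y2|).  The scalars are R[i]; the
   max norm is homogeneous for real scalars only, so the type is an
   lmodType R[i] and a pseudoMetricNormedZmodType R, not a normed space over
   R[i]. *)
Definition complexification (R : realType) (X : normedModType R) : Type :=
  (X * X)%type.

Section Complexification.
Context {R : realType} {X : normedModType R}.
Local Notation E := (complexification X).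
Implicit Types (a b : R[i]) (y z : E).

HB.instance Definition _ := PseudoMetricNormedZmod.copy E (X * X)%type.

Definition cscale a y : E :=
  (complex.Re a *: y.1 - complex.Im a *: y.2,
   complex.Im a *: y.1 + complex.Re a *: y.2).

Fact cscaleA a b y : cscale a (cscale b y) = cscale (a * b) y.
Proof.
case: a b => [a1 a2] [b1 b2]; rewrite /cscale/=; congr pair.
  by rewrite scalerBr scalerDr !scalerA scalerBl scalerDl !opprD addrACA.
by rewrite scalerBr scalerDr !scalerA scalerBl scalerDl addrC addrACA.
Qed.

Fact cscale1 : left_id 1 cscale.
Proof. by case=> y1 y2; rewrite /cscale/= !scale1r !scale0r subr0 add0r. Qed.

Fact cscaleDr : right_distributive cscale +%R.
Proof.
move=> a [y1 y2] [z1 z2]; rewrite /cscale/=; congr pair;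
  by rewrite !scalerDr ?opprD addrACA.
Qed.

Fact cscaleDl y : {morph cscale^~ y : a b / a + b}.
Proof.
case: y => [y1 y2] [a1 a2] [b1 b2]; rewrite /cscale/=; congr pair;
  by rewrite !scalerDl ?opprD addrACA.
Qed.

HB.instance Definition _ := GRing.Zmodule_isLmodule.Build R[i] E
  cscaleA cscale1 cscaleDr cscaleDl.

Definition creal (x : X) : E := (x, 0).

End Complexification.

Section Operators.
Context {R : realType}.
Implicit Types s t : R.

Definition expi t : R[i] := (cos t +i* sin t)%C.

Lemma expiD s t : expi (s + t) = expi s * expi t.
Proof.
rewrite /expi cosD sinD; apply/eqP; rewrite eq_complex/=.
by rewrite eqxx/= addrC eqxx.
Qed.

Lemma expi0 : expi 0 = 1.
Proof. by rewrite /expi cos0 sin0. Qed.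

Lemma expiN t : expi (- t) = (expi t)^-1.
Proof.
have h : expi (- t) * expi t = 1 by rewrite -expiD addNr expi0.
have e0 : expi t != 0.
  by apply/eqP => t0; move: h; rewrite t0 mulr0 => /eqP; rewrite eq_sym oner_eq0.
by apply: (mulIf e0); rewrite h mulVf.
Qed.

Definition gfun t : R[i] := expi (t ^+ 2).

(* Functions on J are represented by total functions on R of which only the
   values on J matter. *)
Definition Delta (Y : zmodType) s (f : R -> Y) t : Y := f (t + s) - f t.

Context {X : normedModType R}.
Local Notation E := (complexification X).
Implicit Types f phi xi : R -> E.

Definition gmul f t : E := gfun t *: f t.
Definition gdiv f t : E := (gfun t)^-1 *: f t.

Definition Top phi s t : E := expi (s ^+ 2 + 2 * s * t) *: phi (s + t) - phi t.
Definition Tlow phi s t : E :=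
  expi (- (s ^+ 2 + 2 * s * t)) *: phi (s + t) - phi t.

Lemma TopE phi s t : Top phi s t = (gfun t)^-1 *: Delta s (gmul phi) t.
Proof.
rewrite /Top /Delta /gmul /gfun -expiN scalerBr !scalerA -!expiD addNr expi0.
by rewrite scale1r (addrC t s); congr (expi _ *: _ - _); ring.
Qed.

Lemma TlowE phi s t : Tlow phi s t = gfun t *: Delta s (gdiv phi) t.
Proof.
rewrite /Tlow /Delta /gdiv /gfun -!expiN scalerBr !scalerA -!expiD subrr expi0.
by rewrite scale1r (addrC t s); congr (expi _ *: _ - _); ring.
Qed.

End Operators.

(* The spaces are stated for pseudoMetricNormedZmodType, the common structure
   of X and of its complexification. *)
Section FunctionSpaces.
Context {R : realType} {Y : pseudoMetricNormedZmodType R}.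
Implicit Types (J : set R) (f : R -> Y).

Definition UC J : set (R -> Y) := [set f | forall e : R, 0 < e ->
  exists2 d : R, 0 < d &
    forall s t, J s -> J t -> `|s - t| < d -> `|f s - f t| < e].

Definition BUC J : set (R -> Y) :=
  [set f | UC J f /\ [bounded f t | t in J]].

(* When J is bounded below, the limit at -oo is along a filter containing the
   empty set, hence holds trivially. *)
Definition C0 J : set (R -> Y) :=
  [set f | [/\ {within J, continuous f},
               f t @[t --> within J +oo] --> 0 &
               f t @[t --> within J -oo] --> 0]].

Definition simple_function f : Prop :=
  finite_set (range f) /\ forall y : Y, measurable (f @^-1` [set y]).

(* Bochner (strong) measurability *)
Definition strongly_measurable J f : Prop :=
  exists2 u : nat -> R -> Y, (forall n, simple_function (u n)) &
    {ae lebesgue_measure, forall t, J t -> u n t @[n --> \oo] --> f t}.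

Definition L1loc J : set (R -> Y) :=
  [set f | strongly_measurable J f /\ forall K, K `<=` J -> compact K ->
     (\int[lebesgue_measure]_(t in K) `|f t|%:E < +oo)%E].

Definition DeltaC0 J : set (R -> Y) :=
  [set f | L1loc J f /\ forall h : R, 0 < h -> C0 J (Delta h f)].

End FunctionSpaces.

Section ProductSpaces.
Context {R : realType} {X : normedModType R}.
Local Notation E := (complexification X).

Definition gdiv_space (J : set R) (F : set (R -> E)) : set (R -> E) :=
  [set phi | exists2 xi, F xi & forall t, J t -> phi t = gdiv xi t].

Definition complex_sum (J : set R) (F : set (R -> X)) : set (R -> E) :=
  [set xi | exists a b, [/\ F a, F b &
    forall t, J t -> xi t = creal (a t) + 'i%C *: creal (b t)]].

End ProductSpaces.

(* Main.v *)
(** If [Delta_s f] vanishes at infinity and is continuous for every [s > 0],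
    then [f] is continuous, with no measurability assumed: the sets of those
    [s] for which [Delta_s f] varies by at most [e] on [[n, oo)] are closed and
    cover the line, so by Baire one of them contains an interval; letting one
    argument tend to infinity, [Delta_s f] is at most [e] there, so [f]
    oscillates by at most [2e] somewhere, hence everywhere, because
    [f(t + h) - f t] is continuous in [t].  So membership in [DeltaC0] reduces
    to [Delta_s f] being in [C0].  The [UC] hypotheses are exploited by the
    fact that [u] and a rotation of [u] can both be uniformly continuous only
    if [u] is bounded (rotation of constant speed) or vanishes at infinity
    (rotation of increasing speed).  *)
Require Import Defs.
From mathcomp Require Import all_boot all_order all_algebra.
From mathcomp Require Import all_classical all_reals all_analysis.
From mathcomp Require Import complex ring lra.
Import Order.TTheory GRing.Theory Num.Theory.
Import numFieldNormedType.Exports.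
Local Open Scope classical_set_scope.
Local Open Scope ring_scope.

(** * Epsilon-delta forms of continuity, decay at infinity and boundedness *)

Section EpsilonDelta.
Context {R : realType} {Y : pseudoMetricNormedZmodType R}.
Implicit Types (J : set R) (f : R -> Y).

Definition cont_on J f : Prop := forall x, J x -> forall e : R, 0 < e ->
  exists2 d : R, 0 < d & forall y, J y -> `|x - y| < d -> `|f x - f y| < e.

Lemma cont_onP J f : {within J, continuous f} <-> cont_on J f.
Proof.
split=> [/subspace_continuousP cf x Jx e e0|cf].
  have /cvgrPdist_lt/(_ e e0) := cf x Jx.
  move/nbhs_ballP => [d /= d0 hd]; exists d => // y Jy xy.
  by apply: hd => //; rewrite -ball_normE.
apply/subspace_continuousP => x Jx; apply/cvgrPdist_lt => e e0.
have [d d0 hd] := cf x Jx e e0.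
apply/nbhs_ballP; exists d => //= y; rewrite -ball_normE /= => xy Jy.
exact: hd.
Qed.

(** The limits at both ends merge into one threshold on [|t|], so that the half-line and the line
    can be treated alike. *)
Lemma C0P J f : C0 J f <-> cont_on J f /\ forall e : R, 0 < e ->
  exists M : R, forall t, J t -> M < `|t| -> `|f t| < e.
Proof.
split=> [[/cont_onP cf /cvgr0Pnorm_lt fp /cvgr0Pnorm_lt fn]|[cf f0]].
  split=> // e e0.
  have [M1 [_ h1]] := fp e e0; have [M2 [_ h2]] := fn e e0.
  exists (Num.max M1 (- M2)) => t Jt; rewrite gt_max => /andP[t1 t2].
  have [t0|t0] := leP 0 t.
    by apply: h1 => //; rewrite -(ger0_norm t0).
  by apply: h2 => //; rewrite (ltr0_norm t0) in t2; lra.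
split; first exact/cont_onP.
  apply/cvgr0Pnorm_lt => e e0; have [M hM] := f0 e e0.
  exists M; split=> [|t Mt Jt]; first exact: num_real.
  by apply: hM => //; exact: lt_le_trans (ler_norm t).
apply/cvgr0Pnorm_lt => e e0; have [M hM] := f0 e e0.
exists (- M); split=> [|t Mt Jt]; first exact: num_real.
by apply: hM => //; rewrite -normrN; apply: lt_le_trans (ler_norm _); lra.
Qed.

Lemma UC_cont_on J f : UC J f -> cont_on J f.
Proof.
move=> uf x Jx e e0; have [d d0 hd] := uf e e0.
by exists d => // y Jy; exact: hd.
Qed.

Lemma boundedP J f :
  [bounded f t | t in J] <-> exists M : R, forall t, J t -> `|f t| <= M.
Proof.
split=> [[M [_ hM]]|[M hM]].
  by exists (M + 1) => t Jt; apply: (hM (M + 1)) => //; lra.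
exists M; split=> [|N MN t Jt]; first exact: num_real.
exact: le_trans (hM t Jt) (ltW MN).
Qed.

End EpsilonDelta.

(** * Properties shared by the two possible domains *)

Section HalfLineOrLine.
Context {R : realType}.

Definition half_or_line (J : set R) := J = `[0, +oo[%classic \/ J = setT.

Variables (J : set R) (hJ : half_or_line J).

Lemma half_or_line_ge0 t : 0 <= t -> J t.
Proof. by move=> t0; case: hJ => -> //=; rewrite in_itv/= t0. Qed.

Lemma half_or_lineD t h : J t -> 0 <= h -> J (t + h).
Proof. by case: hJ => -> //=; rewrite !in_itv/= !andbT; exact: addr_ge0. Qed.

Lemma half_or_line_lt0 t : J t -> t < 0 -> J = setT.
Proof. by case: hJ => -> //=; rewrite in_itv/= andbT leNgt => /negbTE ->. Qed.

End HalfLineOrLine.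

Lemma subrBB {V : zmodType} (x y z : V) : x - z - (y - z) = x - y.
Proof. by rewrite opprB addrA subrK. Qed.

Lemma subrACA {V : zmodType} (x y z t : V) : x - y - (z - t) = x - z - (y - t).
Proof. by rewrite !opprD addrACA. Qed.

Lemma norm_lt_split {R : realType} {Y : pseudoMetricNormedZmodType R}
    (x y : Y) (a b : R) : `|x - y| < a -> `|y| <= b -> `|x| < a + b.
Proof.
by move=> xy yb; rewrite -(subrK y x); have := ler_normD (x - y) y; lra.
Qed.

(** * Continuity of a function from its differences, by Baire category *)

Section ContinuityFromDifferences.
Context {R : realType} {Y : pseudoMetricNormedZmodType R}.
Variables (J : set R) (hJ : half_or_line J) (f : R -> Y).
Hypothesis Df : forall h, 0 < h -> C0 J (Delta h f).

Let Jge0 := half_or_line_ge0 _ hJ.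

(** Requiring [|s| <= n <= u] keeps [u + s] nonnegative, hence in [J], also for negative [s]. *)
Let B (e : R) (n : nat) : set R := [set s | `|s| <= n%:R /\
  forall t u : R, n%:R <= u -> u < t -> `|Delta s f t - Delta s f u| <= e].

(** Second differences are symmetric in their increments. The exchange turns the dependence on [s],
    about which nothing is known, into dependence on the point [u + s], at which [Delta (t - u) f]
    is continuous; this is what makes [B e n] closed. *)
Let DeltaC s t u : Delta s f t - Delta s f u =
  Delta (t - u) f (u + s) - Delta (t - u) f u.
Proof.
rewrite /Delta (_ : u + s + (t - u) = t + s); last by ring.
by rewrite (_ : u + (t - u) = t); [exact: subrACA|ring].
Qed.

Let B_closed e n : closed (B e n).
Proof.
rewrite -openC openE => s /= Bs; apply: contrapT => nint; apply: Bs.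
have approx d : 0 < d -> exists2 r, B e n r & `|s - r| < d.
  move=> d0; apply: contrapT => nex; apply: nint.
  apply/nbhs_ballP; exists d => //= r; rewrite -ball_normE /= => sr Br.
  by apply: nex; exists r.
have sn : `|s| <= n%:R.
  apply/ler_addgt0Pr => d d0; have [r [rn _] sr] := approx d d0.
  have := norm_lt_split _ _ _ _ sr rn; lra.
split=> // t u nu ut; apply/ler_addgt0Pr => d d0.
have tu0 : 0 < t - u by lra.
have Jus r : `|r| <= n%:R -> J (u + r).
  by move=> rn; apply: Jge0; have := ler_norm (- r); rewrite normrN; lra.
have /C0P[cD _] := Df _ tu0.
have [d' d'0 hd'] := cD (u + s) (Jus _ sn) d d0.
have [r [rn hr] sr] := approx d' d'0.
have {}hr := hr t u nu ut.
have := hd' (u + r) (Jus _ rn).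
rewrite (_ : u + s - (u + r) = s - r); last by ring.
move=> /(_ sr) h; rewrite [e + d]addrC; apply: ltW; apply: norm_lt_split (hr).
by rewrite (DeltaC r) (DeltaC s) subrBB.
Qed.

(** A negative increment reduces to a positive one by [Delta s f t = - Delta (- s) f (t + s)]. *)
Let Delta_vanish (s e : R) : 0 < e ->
  exists M : R, forall t, M < t -> `|Delta s f t| < e.
Proof.
move=> e0; have [s0|s0|->] := ltrgt0P s.
- have /C0P[_ /(_ e e0)[M hM]] := Df _ s0.
  exists (Num.max M 0) => t; rewrite gt_max => /andP[Mt t0].
  by apply: hM; [apply: Jge0; lra|rewrite gtr0_norm].
- have s0' : 0 < - s by lra.
  have /C0P[_ /(_ e e0)[M hM]] := Df _ s0'.
  exists (Num.max (M - s) (- s)) => t; rewrite gt_max => /andP[Mt t0].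
  have -> : Delta s f t = - Delta (- s) f (t + s).
    by rewrite /Delta addrK opprB.
  rewrite normrN; apply: hM; first by apply: Jge0; lra.
  by rewrite gtr0_norm; lra.
- by exists 0 => t _; rewrite /Delta addr0 subrr normr0.
Qed.

Let B_cover e : 0 < e -> forall s, exists n, B e n s.
Proof.
move=> e0 s.
have [|M hM] := Delta_vanish s (e / 2); first by lra.
exists (Num.truncn (Num.max `|M| `|s|)).+1.
have := truncnS_gt (Num.max `|M| `|s|).
rewrite gt_max => /andP[Mn sn]; split=> [|t u nu ut]; first exact: ltW.
apply: le_trans (ler_normB _ _) _.
have := hM t; have := hM u; have := ler_norm M; lra.
Qed.

(* Baire: for some n, the bound of [B e n] holds for all s in an interval;
   there u may be sent to infinity. *)
Let small_differences e : 0 < e -> exists s0 d T : R, [/\ 0 < d,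
  0 <= T & forall s t, `|s0 - s| < d -> T <= t ->
  0 <= t + s /\ `|Delta s f t| <= e].
Proof.
move=> e0.
have [n [s0 [d d0 hd]]] : exists n, exists s0, exists2 d : R, 0 < d &
    forall s, `|s0 - s| < d -> B e n s.
  apply: contrapT => noint.
  have [|||s [_ hs]] := @Baire R R (fun n => ~` B e n) _ setT.
  - move=> n; split; first exact/closed_openC/B_closed.
    move=> O [x Ox] oO; apply: contrapT => ON; apply: noint; exists n, x.
    have /nbhs_ballP[d /= d0 hd] := open_nbhs_nbhs (conj oO Ox).
    exists d => // y xy; apply: contrapT => By; apply: ON; exists y.
    by split=> //; apply: hd; rewrite -ball_normE.
  - by exists 0.
  - exact: openT.
  - by have [n] := B_cover _ e0 s; exact: hs.
exists s0, d, n%:R; split=> // s t s0s nt.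
have [sn hs] : B e n s := hd s s0s.
split; first by have := ler_norm (- s); rewrite normrN; lra.
apply/ler_addgt0Pr => c c0; have [M hM] := Delta_vanish s c c0.
pose u := Num.max t M + 1.
have [tu Mu] : t < u /\ M < u.
  by rewrite /u; split; [have : t <= Num.max t M by rewrite le_max lexx|
    have : M <= Num.max t M by rewrite le_max lexx orbT]; lra.
rewrite addrC; have := ltW (hM u Mu).
have := hs u t nt tu; rewrite distrC => h1 h2.
rewrite -(subrK (Delta s f u) (Delta s f t)).
by have := ler_normD (Delta s f t - Delta s f u) (Delta s f u); lra.
Qed.

Lemma cont_on_of_Delta : cont_on J f.
Proof.
move=> x Jx e e0.
have e3 : 0 < e / 3 by lra.
have [s0 [d [T [d0 T0 hT]]]] := small_differences _ e3.
(* This [t] lies beyond [T] and makes [h = t + s0 - x] positive. Shifting by [h] carries [x] to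
   [t + s0] and [y] to [t + s0 + (y - x)], where [f] oscillates by at most [2 e / 3]; the continuity
   of [Delta h f] at [x] supplies the last third. *)
pose t := Num.max T (x - s0) + 1.
have [maxT maxx] : T <= Num.max T (x - s0) /\ x - s0 <= Num.max T (x - s0).
  by split; rewrite le_max lexx ?orbT.
have tT : T <= t by rewrite /t; lra.
have h0 : 0 < t + s0 - x by rewrite /t; lra.
have /C0P[cD _] := Df _ h0.
have [d' d'0 hd'] := cD x Jx (e / 3) e3.
exists (Num.min d d'); first by rewrite lt_min d0.
move=> y Jy; rewrite lt_min => /andP[xyd xyd'].
have {}hd' := hd' y Jy xyd'.
have [_ A1] := hT s0 t ltac:(by rewrite subrr normr0) tT.
have [_ A2] := hT (s0 + (y - x)) t
  ltac:(by rewrite opprD addNKr opprB) tT.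
have -> : f x - f y = Delta s0 f t - Delta (s0 + (y - x)) f t -
   (Delta (t + s0 - x) f x - Delta (t + s0 - x) f y).
  rewrite /Delta (_ : x + (t + s0 - x) = t + s0); last by ring.
  rewrite (_ : y + (t + s0 - x) = t + (s0 + (y - x))); last by ring.
  by rewrite subrBB [X in _ = _ - X]subrACA subKr.
have := ler_normB (Delta s0 f t - Delta (s0 + (y - x)) f t)
  (Delta (t + s0 - x) f x - Delta (t + s0 - x) f y).
have := ler_normB (Delta s0 f t) (Delta (s0 + (y - x)) f t); lra.
Qed.

End ContinuityFromDifferences.

(** * Strong measurability and local integrability of continuous functions *)

Section LocalIntegrability.
Import HBSimple.
Context {R : realType} {Y : pseudoMetricNormedZmodType R}.
Variables (J : set R) (hJ : half_or_line J).
Implicit Types f : R -> Y.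

(** Since preimages of arbitrary sets are measurable, [f \o q n] is simple for every [f]; since the
    values stay in [J], continuity of [f] on [J] makes these compositions converge to [f] there. *)
Lemma simple_approximation : exists q : nat -> R -> R,
  [/\ forall n, finite_set (range (q n)),
      forall n A, measurable (q n @^-1` A),
      forall n t, J (q n t) &
      forall t, J t -> q n t @[n --> \oo] --> t].
Proof.
have [g hg] := approximation_sfun measurableT
  (@measurable_realfun.EFin_measurable R setT).
have mg n (A : set R) : measurable (g n @^-1` A).
  (* Only the finitely many values of [g n] lying in [A] matter, and a finite set is measurable. *)
  have -> : g n @^-1` A = g n @^-1` (A `&` range (g n)).
    by apply/seteqP; split=> [t At|t []//]; split=> //; exists t.
  apply: measurable_funPTI; apply: countable_measurable => //.
  by apply: finite_set_countable; apply: finite_setIr; exact: fimfunP.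
have cg t : g n t @[n --> \oo] --> t by exact: fine_cvg (hg t I).
case: hJ => ->; last first.
  by exists g; split=> // n; exact: fimfunP.
(* On the half-line, cutting off at 0 puts the values in [J] and moves them no farther from
   [t >= 0]. *)
exists (fun n t => Num.max (g n t) 0); split.
- move=> n; have := @fimfunP _ _ (g n).
  move/(finite_image (fun x => Num.max x 0)); apply: sub_finite_set.
  by move=> _ [t _ <-]; exists (g n t).
- by move=> n A; exact: (mg n ((fun x => Num.max x 0) @^-1` A)).
- by move=> n t /=; rewrite in_itv/= andbT le_max lexx orbT.
- move=> t /=; rewrite in_itv/= andbT => t0.
  apply/cvgrPdist_lt => e e0; have /cvgrPdist_lt/(_ e e0) := cg t.
  apply: filterS => n; apply: le_lt_trans.
  have [//|g0] := leP 0 (g n t).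
  by rewrite subr0 !ger0_norm; lra.
Qed.

Lemma L1loc_of_cont f : cont_on J f -> L1loc J f.
Proof.
move=> cf; split.
  have [q [fq mq Jq cq]] := simple_approximation.
  have fq_simple n : simple_function (f \o q n).
    split=> [|y]; last exact: (mq n (f @^-1` [set y])).
    rewrite (_ : range _ = f @` range (q n)); first exact: finite_image.
    by rewrite image_comp.
  have fq_cvg t : J t -> (f \o q n) t @[n --> \oo] --> f t.
    move=> Jt; apply/cvgrPdist_lt => e e0.
    have [d d0 hd] := cf t Jt e e0.
    have /cvgrPdist_lt/(_ d d0) := cq t Jt.
    by apply: filterS => n /hd; apply; exact: Jq.
  by exists (fun n => f \o q n) => //; apply: aeW => t; exact: fq_cvg.
move=> K KJ cK.
apply: integrable_lty; first exact: measurable_realfun.compact_measurable.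
apply: (@continuous_compact_integrable R (fun t => `|f t|)) => //.
apply/cont_onP => x Kx e e0; have [d d0 hd] := cf x (KJ x Kx) e e0.
exists d => // y Ky xy; apply: le_lt_trans (ler_dist_dist _ _) _.
by apply: hd => //; exact: KJ.
Qed.

Lemma DeltaC0P f : DeltaC0 J f <-> forall h, 0 < h -> C0 J (Delta h f).
Proof.
split=> [[]//|Df]; split=> //.
exact/L1loc_of_cont/cont_on_of_Delta.
Qed.

End LocalIntegrability.

(** * Rotations in the max norm and their effect on continuity *)

Lemma lipschitz1_of_derive {R : realType} (f df : R -> R) :
  (forall x : R, is_derive x 1 f (df x)) -> (forall x, `|df x| <= 1) ->
  forall x y, `|f x - f y| <= `|x - y|.
Proof.
move=> fdf df1 x y; wlog xy : x y / y <= x.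
  move=> H; have [/H//|/ltW/H] := leP y x.
  by rewrite distrC (distrC y).
have [|c _ ->] := @MVT_segment R f df y x xy.
  by apply: derivable_within_continuous => z _; have [] := fdf z.
by rewrite normrM ler_piMl.
Qed.

Section Rotation.
Context {R : realType} {X : normedModType R}.
Local Notation E := (complexification X).
Implicit Types (y z : E) (J : set R).

Lemma norm_cscale (a : R[i]) y :
  `|a *: y| <= (`|complex.Re a| + `|complex.Im a|) * `|y|.
Proof.
have [y1 y2] : `|y.1| <= `|y| /\ `|y.2| <= `|y|.
  by rewrite prod_normE !le_max !lexx orbT.
rewrite [leLHS]prod_normE ge_max /= mulrDl; apply/andP; split.
  apply: le_trans (ler_normB _ _) _; rewrite !normrZ.
  by apply: lerD; exact: ler_wpM2l.
apply: le_trans (ler_normD _ _) _; rewrite !normrZ addrC.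
by apply: lerD; exact: ler_wpM2l.
Qed.

(* The max norm is not invariant under rotations, whence the factor 2. *)
Lemma norm_expi (t : R) y : `|expi t *: y| <= 2 * `|y|.
Proof.
apply: le_trans (norm_cscale _ _) _; apply: ler_wpM2r => //=.
have : `|cos t| <= 1 by rewrite ler_norml cos_geN1 cos_le1.
have : `|sin t| <= 1 by rewrite ler_norml sin_geN1 sin_le1.
lra.
Qed.

Lemma norm_le_expi (t : R) y : `|y| <= 2 * `|expi t *: y|.
Proof.
rewrite -[in leLHS](scale1r y) -(expi0 (R := R)) -(addNr t) expiD -scalerA.
exact: norm_expi.
Qed.

(** The change of phase is charged to [y] alone, so it costs the size of the vector; this is why
    [UC_expi] starts from a bounded function. *)
Lemma norm_expiB (a b : R) y z :
  `|expi a *: y - expi b *: z| <= 2 * `|y - z| + 2 * (`|a - b| * `|y|).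
Proof.
have -> : expi a *: y - expi b *: z =
    expi b *: (y - z) + (expi a - expi b) *: y.
  by rewrite scalerBr scalerBl [RHS]addrC addrA subrK.
apply: le_trans (ler_normD _ _) _; apply: lerD; first exact: norm_expi.
apply: le_trans (norm_cscale _ _) _; rewrite mulrA; apply: ler_wpM2r => //=.
have : `|cos a - cos b| <= `|a - b|.
  apply: (lipschitz1_of_derive _ (fun x => - sin x)) => x.
  by rewrite normrN ler_norml sin_geN1 sin_le1.
have : `|sin a - sin b| <= `|a - b|.
  apply: (lipschitz1_of_derive _ cos) => x.
  by rewrite ler_norml cos_geN1 cos_le1.
lra.
Qed.

Lemma cont_on_expi J (p : R -> R) (f : R -> E) :
  continuous p -> cont_on J f -> cont_on J (fun t => expi (p t) *: f t).
Proof.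
move=> cp cf x Jx e e0.
have [d1 d10 h1] := cf x Jx (e / 4) ltac:(lra).
have f0 : 0 < 4 * (1 + `|f x|) by have := normr_ge0 (f x); lra.
have /cvgrPdist_lt/(_ (e / (4 * (1 + `|f x|)))) := cp x.
move=> /(_ (divr_gt0 e0 f0))/nbhs_ballP[d2 /= d20 h2].
exists (Num.min d1 d2); first by rewrite lt_min d10.
move=> y Jy; rewrite lt_min => /andP[/(h1 y Jy) {}h1 xy2].
have {}h2 : `|p x - p y| < e / (4 * (1 + `|f x|)).
  by apply: h2; rewrite -ball_normE.
apply: le_lt_trans (norm_expiB _ _ _ _) _.
have : `|p x - p y| * `|f x| <= e / 4.
  apply: le_trans (_ : `|p x - p y| * (1 + `|f x|) <= _).
    by apply: ler_wpM2l => //; lra.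
  rewrite -ler_pdivlMr; last by have := normr_ge0 (f x); lra.
  by rewrite -mulrA -invfM; exact: ltW.
lra.
Qed.

Lemma C0_expi J (p : R -> R) (f : R -> E) :
  continuous p -> C0 J f -> C0 J (fun t => expi (p t) *: f t).
Proof.
move=> cp /C0P[cf f0]; apply/C0P; split; first exact: cont_on_expi.
move=> e e0; have [M hM] := f0 (e / 2) ltac:(lra).
exists M => t Jt Mt; have := hM t Jt Mt; have := norm_expi (p t) (f t); lra.
Qed.

Lemma UC_expi J (a b : R) (f : R -> E) : BUC J f ->
  UC J (fun t => expi (a * t + b) *: f t).
Proof.
move=> [uf /boundedP[M hM]] e e0; have [d d0 hd] := uf (e / 4) ltac:(lra).
(* Adding 1 to [|a|] and [|M|] keeps the divisor positive even if they vanish. *)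
have K0 : 0 < 4 * ((1 + `|a|) * (1 + `|M|)).
  by apply: mulr_gt0 => //; apply: mulr_gt0; rewrite ltr_pwDl.
exists (Num.min d (e / (4 * ((1 + `|a|) * (1 + `|M|))))).
  by rewrite lt_min d0 divr_gt0.
move=> s t Js Jt; rewrite lt_min => /andP[/(hd s t Js Jt) {}hd].
rewrite ltr_pdivlMr // => st.
apply: le_lt_trans (norm_expiB _ _ _ _) _.
rewrite (_ : a * s + b - (a * t + b) = a * (s - t)); last by ring.
rewrite normrM; have := hM s Js; have := ler_norm M; move: st hd.
have := normr_ge0 (f s); have := normr_ge0 a; have := normr_ge0 (s - t).
set A := `|a|; set D := `|s - t|; set F := `|f s|; set N := `|M|.
move=> D0 A0 F0 De hd MN FM.
suff : A * D * F <= D * ((1 + A) * (1 + N)) by lra.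
rewrite [A * D]mulrC -mulrA; apply: ler_wpM2l => //.
by apply: ler_pM => //; lra.
Qed.

End Rotation.

(** * Closure properties of uniformly continuous functions *)

Section UniformContinuity.
Context {R : realType} {Y : pseudoMetricNormedZmodType R}.
Implicit Types (J : set R) (f : R -> Y).

Lemma UCB J f g : UC J f -> UC J g -> UC J (fun t => f t - g t).
Proof.
move=> uf ug e e0; have [d1 d10 h1] := uf (e / 2) ltac:(lra).
have [d2 d20 h2] := ug (e / 2) ltac:(lra).
exists (Num.min d1 d2); first by rewrite lt_min d10.
move=> s t Js Jt; rewrite lt_min.
move=> /andP[/(h1 _ _ Js Jt) {}h1 /(h2 _ _ Js Jt) {}h2].
by rewrite subrACA; have := ler_normB (f s - f t) (g s - g t); lra.
Qed.

Lemma UC_shift J f h : half_or_line J -> 0 <= h -> UC J f ->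
  UC J (fun t => f (t + h)).
Proof.
move=> hJ h0 uf e e0; have [d d0 hd] := uf e e0; exists d => // s t Js Jt st.
apply: hd; [exact: half_or_lineD|exact: half_or_lineD|].
by rewrite opprD addrACA subrr addr0.
Qed.

Lemma BUCB J f g : BUC J f -> BUC J g -> BUC J (fun t => f t - g t).
Proof.
move=> [uf /boundedP[M hM]] [ug /boundedP[N hN]].
split; first exact: UCB.
apply/boundedP; exists (M + N) => t Jt.
by apply: le_trans (ler_normB _ _) _; apply: lerD; [exact: hM|exact: hN].
Qed.

Lemma BUC_shift J f h : half_or_line J -> 0 <= h -> BUC J f ->
  BUC J (fun t => f (t + h)).
Proof.
move=> hJ h0 [uf /boundedP[M hM]]; split; first exact: UC_shift.
by apply/boundedP; exists M => t Jt; apply: hM; exact: half_or_lineD.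
Qed.

Lemma eq_BUC J f g : (forall t, J t -> f t = g t) -> BUC J f -> BUC J g.
Proof.
move=> fg [uf /boundedP[M hM]]; split.
  move=> e e0; have [d d0 hd] := uf e e0; exists d => // s t Js Jt.
  by rewrite -!fg //; exact: hd.
by apply/boundedP; exists M => t Jt; rewrite -fg //; exact: hM.
Qed.

End UniformContinuity.

(** * Boundedness forced by rotations of constant speed *)

Section Oscillation.
Context {R : realType} {X : normedModType R}.
Local Notation E := (complexification X).
Variables (J : set R) (hJ : half_or_line J).
Implicit Types phi xi : R -> E.

Let JD := half_or_lineD _ hJ.

Lemma BUC_expi (a b : R) phi : BUC J phi ->
  BUC J (fun t => expi (a * t + b) *: phi t).
Proof.
move=> /[dup] /(@UC_expi _ _ _ a b) uphi [_ /boundedP[M hM]]; split=> //.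
apply/boundedP; exists (2 * M) => t Jt; apply: le_trans (norm_expi _ _) _.
by have := hM t Jt; lra.
Qed.

Lemma BUC_cscale (c : R[i]) phi : BUC J phi -> BUC J (fun t => c *: phi t).
Proof.
set k := `|complex.Re c| + `|complex.Im c|.
have k0 : 0 <= k by rewrite addr_ge0.
move=> [uf /boundedP[M hM]]; split=> [e e0|].
  have k1 : 0 < k + 1 by lra.
  have [d d0 hd] := uf _ (divr_gt0 e0 k1); exists d => // s t Js Jt st.
  rewrite -scalerBr; apply: le_lt_trans (norm_cscale _ _) _.
  have := hd s t Js Jt st; rewrite ltr_pdivlMr // -/k.
  have := normr_ge0 (phi s - phi t); lra.
apply/boundedP; exists (k * M) => t Jt; apply: le_trans (norm_cscale _ _) _.
by apply: ler_wpM2l => //; exact: hM.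
Qed.

(* Over a fixed small increment [h] the phase changes by a fixed angle
   [a * h] that is not a multiple of [2 * pi], while [f] and its rotation move
   by at most 1. *)
Lemma bounded_of_rotation (a b : R) phi : a != 0 -> UC J phi ->
  UC J (fun t => expi (a * t + b) *: phi t) ->
  exists M : R, forall t, J t -> `|phi t| <= M.
Proof.
move=> a0 uphi uw.
have [d1 d10 h1] := uphi 1 ltr01; have [d2 d20 h2] := uw 1 ltr01.
have na0 : 0 < `|a| by rewrite normr_gt0.
pose h := Num.min (Num.min d1 d2 / 2) (`|a|^-1).
have d0 : 0 < Num.min d1 d2 by rewrite lt_min d10.
have h0 : 0 < h by rewrite lt_min invr_gt0 na0 divr_gt0.
have [hd1 hd2] : h < d1 /\ h < d2.
  have : h <= Num.min d1 d2 / 2 by rewrite ge_min lexx.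
  have : Num.min d1 d2 <= d1 by rewrite ge_min lexx.
  have : Num.min d1 d2 <= d2 by rewrite ge_min lexx orbT.
  by split; lra.
have ah : 0 < `|a| * h < pi.
  rewrite mulr_gt0 //=; apply: (@le_lt_trans _ _ 1).
    by rewrite -ler_pdivlMl // mulr1 ge_min lexx orbT.
  by apply: lt_le_trans (pi_ge2 R); lra.
pose c : R[i] := expi (a * h) - 1.
have c0 : c != 0.
  apply/eqP => /(congr1 (@complex.Im R)) /= /eqP; rewrite subr0 -normr_eq0.
  have -> : `|sin (a * h)| = `|sin (`|a| * h)|.
    by have [_|_] := ger0P a; rewrite // mulNr sinN normrN.
  by rewrite gt_eqF // normr_gt0 gt_eqF // sin_gt0_pi.
pose k := `|complex.Re c^-1| + `|complex.Im c^-1|.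
(* The 3 is 1 for the increment of the rotated function plus 2 for the rotated increment of [phi];
   [k] bounds multiplication by [c^-1], and the outer 2 pays for undoing the rotation. *)
exists (2 * (k * 3)) => t Jt.
apply: le_trans (norm_le_expi (a * t + b) _) _.
rewrite ler_pM2l //; set w := _ *: _.
rewrite -[w]scale1r -(mulVf c0) -scalerA.
apply: le_trans (norm_cscale _ _) _; apply: ler_wpM2l; first exact: addr_ge0.
have Jth : J (t + h) by apply: JD => //; exact: ltW.
have htt : `|t + h - t| = h by rewrite addrAC subrr add0r gtr0_norm.
have {}h1 := h1 (t + h) t Jth Jt ltac:(by rewrite htt).
have {}h2 := h2 (t + h) t Jth Jt ltac:(by rewrite htt).
have -> : c *: w = (expi (a * (t + h) + b) *: phi (t + h) - w)
    - expi (a * (t + h) + b) *: (phi (t + h) - phi t).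
  rewrite scalerBr opprB addrC subrKA /c scalerBl scale1r /w scalerA -expiD.
  by congr (expi _ *: _ - _); ring.
apply: le_trans (ler_normB _ _) _.
have := norm_expi (a * (t + h) + b) (phi (t + h) - phi t).
by rewrite /w; lra.
Qed.

(** A common form of both operators: [c = 1] gives [Top] and [c = -1] gives [Tlow]. *)
Definition twist (c : R) phi (s t : R) : E :=
  expi (c * (s ^+ 2 + 2 * s * t)) *: phi (s + t) - phi t.

(** A cocycle identity. For fixed [r] the phase in front of [twist c phi s (t + r)] is affine in
    [t], so it exhibits a rotation of constant speed as a difference of two twists, which is the
    input of [bounded_of_rotation]. *)
Lemma twistD c phi r s t : twist c phi (s + r) t =
  expi (c * (r ^+ 2 + 2 * r * t)) *: twist c phi s (t + r) + twist c phi r t.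
Proof.
rewrite /twist scalerBr scalerA -expiD (addrC r t) subrKA.
rewrite (_ : s + r + t = s + (t + r)); last by ring.
by congr (expi _ *: _ - _); ring.
Qed.

Lemma twist_BUC (c : R) phi : c != 0 ->
  (forall s, 0 < s -> UC J (twist c phi s)) ->
  forall s, 0 < s -> BUC J (twist c phi s).
Proof.
move=> c0 uphi s s0; split; first exact: uphi.
have [d d0 hd] := uphi s s0 1 ltr01.
(* The bound will be obtained at [t + r] only; as [r < d], going back to [t] costs at most 1. *)
pose r := d / 2; have r0 : 0 < r by rewrite /r; lra.
have [|||M hM] := @bounded_of_rotation (c * (2 * r)) (c * r ^+ 2)
    (fun t => twist c phi s (t + r)).
- by rewrite !mulf_neq0 // gt_eqF.
- by apply: UC_shift (uphi s s0) => //; exact: ltW.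
- have := UCB _ _ _ (uphi (s + r) (addr_gt0 s0 r0)) (uphi r r0).
  congr UC; apply/funext => t; rewrite twistD addrK.
  by congr (expi _ *: _); ring.
apply/boundedP; exists (1 + M) => t Jt.
have Jtr : J (t + r) by apply: JD => //; exact: ltW.
apply: ltW; apply: norm_lt_split (hM t Jt); apply: hd => //.
rewrite opprD addrA subrr add0r normrN gtr0_norm /r; lra.
Qed.

End Oscillation.

(** * The quadratic phase, and passage to components *)

Section Quadratic.
Context {R : realType} {X : normedModType R}.
Local Notation E := (complexification X).
Variables (J : set R) (hJ : half_or_line J).
Implicit Types phi xi : R -> E.

Lemma gdivE phi t : gdiv phi t = expi (- t ^+ 2) *: phi t.
Proof. by rewrite /gdiv /gfun -expiN. Qed.

Lemma gdivK phi : gmul (gdiv phi) = phi.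
Proof.
by apply/funext => t; rewrite /gmul gdivE scalerA -expiD subrr expi0 scale1r.
Qed.

Lemma gmulK phi : gdiv (gmul phi) = phi.
Proof.
by apply/funext => t; rewrite gdivE /gmul scalerA -expiD addNr expi0 scale1r.
Qed.

(* With [s ^ 2 = pi / 4], the functions [(Top - Tlow) phi s] and
   [(Top - Tlow) phi (2 s)], the former shifted by [s], are
   [2i sin(alpha) phi(. + 2 s)] and [- 2i cos(2 alpha) phi(. + 2 s)], and
   [2 sin(alpha)^2 + cos(2 alpha) = 1]. *)
Lemma BUC_of_Top_Tlow phi :
  (forall s, 0 < s -> UC J (Top phi s)) ->
  (forall s, 0 < s -> UC J (Tlow phi s)) -> BUC J phi.
Proof.
move=> uT uL.
have TopE1 s : Top phi s = twist 1 phi s.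
  by apply/funext => t; rewrite /twist mul1r.
have TlowE1 s : Tlow phi s = twist (-1) phi s.
  by apply/funext => t; rewrite /twist mulN1r.
have {}uT s : 0 < s -> BUC J (Top phi s).
  rewrite TopE1; apply: twist_BUC => // r r0.
  by rewrite -TopE1; exact: uT.
have {}uL s : 0 < s -> BUC J (Tlow phi s).
  rewrite TlowE1; apply: twist_BUC => // r r0.
  by rewrite -TlowE1; exact: uL.
pose q : R := Num.sqrt pi / 2.
have q0 : 0 < q by rewrite divr_gt0 // sqrtr_gt0 pi_gt0.
have q2 : q ^+ 2 = pi / 4.
  by rewrite expr_div_n sqr_sqrtr ?pi_ge0 // -natrX.
have qq0 : 0 < 2 * q by lra.
pose D1 t := Top phi q (t + q) - Tlow phi q (t + q).
pose D2 t := Top phi (2 * q) t - Tlow phi (2 * q) t.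
have uD1 : BUC J D1.
  by apply: BUCB; apply: (BUC_shift _ _ _ hJ (ltW q0)); [exact: uT|exact: uL].
have uD2 : BUC J D2 by apply: BUCB; [exact: uT|exact: uL].
pose P t := phi (2 * q + t).
have uP : BUC J P.
  (* With [a] and [b] the exponentials of [alpha] and [- alpha], [i D2 = (a^2 + b^2) P] and
     [(a - b) D1 = (a - b)^2 P]; they differ by [2 a b P = 2 P]. The phases multiplying [D1] are
     affine, so boundedness and uniform continuity survive. *)
  apply: (eq_BUC _ (fun t => 2^-1 *: ('i%C *: D2 t -
    (expi (2 * q * t + 3 * q ^+ 2) *: D1 t -
     expi (- (2 * q) * t + - (3 * q ^+ 2)) *: D1 t)))).
    move=> t _.
    pose a : R[i] := expi (2 * q * t + 3 * q ^+ 2).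
    pose b : R[i] := expi (- (2 * q * t + 3 * q ^+ 2)).
    have ab : a * b = 1 by rewrite -expiD subrr expi0.
    have ii : 'i%C * 'i%C = -1 :> R[i] by rewrite -expr2 sqr_i.
    have epi : expi (pi / 2) = 'i%C :> R[i].
      by rewrite /expi cos_pihalf sin_pihalf.
    have -> : D1 t = (a - b) *: P t.
      rewrite /D1 /Top /Tlow subrBB -scalerBl /P.
      rewrite (_ : q + (t + q) = 2 * q + t); last by ring.
      by congr ((expi _ - expi _) *: _); ring.
    have -> : D2 t = (- 'i%C * a ^+ 2 - 'i%C * b ^+ 2) *: P t.
      rewrite /D2 /Top /Tlow subrBB -scalerBl; congr (_ *: _).
      have -> : - 'i%C = expi (- (pi / 2)) :> R[i].
        rewrite expiN epi; apply: (mulfI (_ : 'i%C != 0 :> R[i])).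
          exact: neq0Ci.
        by rewrite mulrN ii opprK mulfV // neq0Ci.
      rewrite -epi !expr2 -!expiD.
      have -> : pi / 2 = 2 * q ^+ 2 by rewrite q2; lra.
      by congr (expi _ - expi _); ring.
    rewrite (_ : - (2 * q) * t + _ = - (2 * q * t + 3 * q ^+ 2)); last by ring.
    rewrite -/a -/b !scalerA -!scalerBl scalerA.
    rewrite (_ : _ * _ = 1) ?scale1r //.
    have -> : 'i%C * (- 'i%C * a ^+ 2 - 'i%C * b ^+ 2) = a ^+ 2 + b ^+ 2.
      by rewrite mulrBr !mulrA mulrN ii; ring.
    rewrite (_ : _ - _ = 2 * (a * b)); last by ring.
    by rewrite ab mulr1 mulVf // pnatr_eq0.
  apply: BUC_cscale; apply: BUCB; first exact: BUC_cscale.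
  by apply: BUCB; exact: BUC_expi.
(* On the half-line [P] sees [phi] only from [2 q] on; the values before are recovered by solving
   the definition of [Top phi (2 * q) t] for [phi t]. *)
apply: (eq_BUC _ (fun t => expi (2 * (2 * q) * t + (2 * q) ^+ 2) *: P t
  - Top phi (2 * q) t)).
  move=> t _; rewrite /Top /P addrC opprB.
  by rewrite [(2 * q) ^+ 2 + _]addrC subrK.
by apply: BUCB; [exact: BUC_expi|exact: uT].
Qed.

Lemma sqr_continuous : continuous (fun t : R => t ^+ 2).
Proof. exact: exprn_continuous. Qed.

(* Moving [t] to the nearby [t'] with [t' ^ 2 = t ^ 2 + pi / 2] multiplies [g]
   by [i] and [1 / g] by [- i]; hence both [i * xi t' - xi t] and
   [- i * xi t' - xi t] are small. *)
Lemma C0_of_UC_gmul_gdiv xi : UC J (gmul xi) -> UC J (gdiv xi) -> C0 J xi.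
Proof.
move=> um ud; apply/C0P; split.
  rewrite -(gmulK xi) (_ : gdiv _ = fun t => expi (- t ^+ 2) *: gmul xi t).
    apply: cont_on_expi; last exact: UC_cont_on.
    by move=> t; apply: cvgN; exact: sqr_continuous.
  by apply/funext => t; exact: gdivE.
move=> e e0; have [d1 d10 h1] := um (e / 4) ltac:(lra).
have [d2 d20 h2] := ud (e / 4) ltac:(lra).
pose d := Num.min d1 d2; have d0 : 0 < d by rewrite lt_min d10.
(* Beyond this threshold [pi / 2 < 2 d |t|], so the root of [t ^ 2 + pi / 2] is less than
   [|t| + d]. *)
exists (pi / (4 * d)) => t Jt; rewrite ltr_pdivrMr ?mulr_gt0 // => Mt.
pose r := Num.sqrt (t ^+ 2 + pi / 2).
have pi0 := pi_gt0 R.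
have t2 : 0 <= t ^+ 2 by rewrite sqr_ge0.
have r2 : r ^+ 2 = t ^+ 2 + pi / 2 by rewrite sqr_sqrtr //; lra.
have r0 : 0 <= r by rewrite sqrtr_ge0.
have rt : `|t| <= r.
  by rewrite -ler_sqr ?nnegrE // r2 real_normK ?num_real //; lra.
have rd : r < `|t| + d.
  have t0 := normr_ge0 t.
  rewrite -ltr_sqr ?nnegrE //; last by lra.
  by rewrite r2 sqrrD real_normK ?num_real // -subr_gt0; have := sqr_ge0 d; lra.
(* The root is given the sign of [t]; a negative [t] occurs only when [J] is the whole line. *)
have [t' [Jt' t'2 tt']] : exists t', [/\ J t', t' ^+ 2 = t ^+ 2 + pi / 2 &
    `|t' - t| < d].
  have [t0|t0] := leP 0 t.
    exists r; split=> //; first exact: half_or_line_ge0.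
    by rewrite (ger0_norm t0) in rt rd; rewrite ger0_norm; lra.
  exists (- r); split; rewrite ?sqrrN //.
    by rewrite (half_or_line_lt0 _ hJ _ Jt t0).
  by rewrite (ltr0_norm t0) in rt rd; rewrite ler0_norm; lra.
have [td1 td2] : `|t' - t| < d1 /\ `|t' - t| < d2.
  by move: tt'; rewrite lt_min => /andP.
pose z := expi (pi / 2) *: xi t'; pose z' := expi (- (pi / 2)) *: xi t'.
have zz' : z' = - z.
  have expiN2 : expi (- (pi / 2)) = - expi (pi / 2) :> R[i].
    apply/eqP; rewrite /expi cosN sinN cos_pihalf sin_pihalf eq_complex /=.
    by rewrite oppr0 !eqxx.
  by rewrite /z /z' expiN2 scaleNr.
have A1 : `|z - xi t| <= e / 2.
  apply: le_trans (norm_le_expi (t ^+ 2) _) _.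
  rewrite scalerBr scalerA -expiD -t'2.
  by have := h1 t' t Jt' Jt td1; rewrite /gmul /gfun; lra.
have A2 : `|z' - xi t| <= e / 2.
  apply: le_trans (norm_le_expi (- t ^+ 2) _) _.
  rewrite scalerBr scalerA -expiD -opprD -t'2.
  by have := h2 t' t Jt' Jt td2; rewrite !gdivE; lra.
have : `|xi t *+ 2| <= e.
  rewrite (_ : xi t *+ 2 = - ((z - xi t) + (z' - xi t))).
    by rewrite normrN; have := ler_normD (z - xi t) (z' - xi t); lra.
  by rewrite zz' addrACA subrr add0r opprD opprK.
by rewrite normrMn mulr2n; lra.
Qed.

Lemma C0_Delta_gmul phi s : C0 J (Top phi s) -> C0 J (Delta s (gmul phi)).
Proof.
move/(C0_expi _ (fun t => t ^+ 2) _ sqr_continuous); congr C0.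
by apply/funext => t; rewrite TopE -/(gfun t) /gfun scalerA -expiN -expiD subrr
  expi0 scale1r.
Qed.

Lemma C0_components xi (a b : R -> X) :
  (forall t, J t -> xi t = (a t, b t)) ->
  C0 J xi <-> C0 J a /\ C0 J b.
Proof.
move=> xiE.
have xi_norm t u : J t -> J u ->
    `|xi t - xi u| = Num.max `|a t - a u| `|b t - b u|.
  by move=> Jt Ju; rewrite !xiE // prod_normE.
have xi_norm0 t : J t -> `|xi t| = Num.max `|a t| `|b t|.
  by move=> Jt; rewrite xiE // prod_normE.
split=> [/C0P[cx x0]|[/C0P[ca a0] /C0P[cb b0]]].
  have cont x e : J x -> 0 < e -> exists2 d : R, 0 < d & forall y, J y ->
      `|x - y| < d -> `|a x - a y| < e /\ `|b x - b y| < e.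
    move=> Jx e0; have [d d0 hd] := cx x Jx e e0; exists d => // y Jy.
    by move=> /(hd y Jy); rewrite xi_norm // gt_max => /andP.
  have decay e : 0 < e -> exists M : R, forall t, J t -> M < `|t| ->
      `|a t| < e /\ `|b t| < e.
    move=> e0; have [M hM] := x0 e e0; exists M => t Jt /(hM t Jt).
    by rewrite xi_norm0 // gt_max => /andP.
  split; apply/C0P; (split=> [x Jx e e0|e e0];
    [have [d d0 hd] := cont x e Jx e0; exists d => // y Jy /(hd y Jy)[]
    |have [M hM] := decay e e0; exists M => t Jt /(hM t Jt)[]]) => //.
apply/C0P; split=> [x Jx e e0|e e0].
  have [d d0 hd] := ca x Jx e e0; have [d' d'0 hd'] := cb x Jx e e0.
  exists (Num.min d d'); first by rewrite lt_min d0.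
  move=> y Jy; rewrite lt_min => /andP[xyd xyd'].
  by rewrite xi_norm // gt_max hd // hd'.
have [M hM] := a0 e e0; have [M' hM'] := b0 e e0.
exists (Num.max M M') => t Jt; rewrite gt_max => /andP[Mt M't].
by rewrite xi_norm0 // gt_max hM // hM'.
Qed.

Lemma complex_sumE (a b : X) : creal a + 'i%C *: creal b = (a, b).
Proof.
rewrite /creal; congr pair => /=.
  by rewrite scale0r scaler0 subrr addr0.
by rewrite scaler0 addr0 scale1r add0r.
Qed.

(** [DeltaC0P] turns this into a claim on [C0] of the differences, where the max norm splits by
    components. *)
Lemma DeltaC0_components xi (a b : R -> X) :
  (forall t, J t -> xi t = (a t, b t)) ->
  DeltaC0 J xi <-> DeltaC0 J a /\ DeltaC0 J b.
Proof.
move=> xiE; have DE h t : 0 < h -> J t ->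
    Delta h xi t = (Delta h a t, Delta h b t).
  move=> h0 Jt; rewrite /Delta !xiE //.
  by apply: half_or_lineD => //; exact: ltW.
split=> [/(DeltaC0P _ hJ) Dx|[/(DeltaC0P _ hJ) Da /(DeltaC0P _ hJ) Db]].
  by split; apply/(DeltaC0P _ hJ) => h h0;
    have /(C0_components _ _ _ (DE h ^~ h0))[] := Dx h h0.
apply/(DeltaC0P _ hJ) => h h0.
by apply/(C0_components _ _ _ (DE h ^~ h0)); split; [exact: Da|exact: Db].
Qed.

End Quadratic.

Theorem theorem3p1 (R : realType) (X : completeNormedModType R) (J : set R)
    (hJ : J = `[0, +oo[%classic \/ J = setT) :
  [/\ forall phi : R -> complexification X,
        (forall s, 0 < s -> UC J (Top phi s)) ->
        (forall s, 0 < s -> UC J (Tlow phi s)) ->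
        BUC J phi,
      forall phi : R -> complexification X,
        (forall s, 0 < s -> C0 J (Top phi s)) ->
        gdiv_space J (DeltaC0 J) phi &
      (forall xi : R -> complexification X,
        (forall s, 0 < s -> UC J (Top (gdiv xi) s)) ->
        (forall s, 0 < s -> UC J (Tlow (gmul xi) s)) ->
        DeltaC0 J xi) /\
      DeltaC0 J = complex_sum J (DeltaC0 J) :> set (R -> complexification X)].
Proof.
split=> [phi|phi Tphi|]; first exact: BUC_of_Top_Tlow.
  exists (gmul phi); last by move=> t _; rewrite gmulK.
  by apply/(DeltaC0P _ hJ) => s s0; apply: C0_Delta_gmul; exact: Tphi.
split=> [xi uT uL|].
  (* By [TlowE] and [TopE] the two hypotheses say that [Delta s xi], multiplied and divided by
     [gfun], is uniformly continuous. *)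
  apply/(DeltaC0P _ hJ) => s s0; apply: C0_of_UC_gmul_gdiv => //.
    have := uL s s0; congr UC; apply/funext => t.
    by rewrite TlowE gmulK.
  have := uT s s0; congr UC; apply/funext => t.
  by rewrite TopE gdivK.
apply/seteqP; split=> [xi Dxi|xi [a [b [Da Db xiE]]]].
  have xiE t : J t -> xi t = ((fst \o xi) t, (snd \o xi) t).
    by move=> _ /=; case: (xi t).
  have /(DeltaC0_components _ hJ _ _ _ xiE)[Da Db] := Dxi.
  by exists (fst \o xi), (snd \o xi); split=> // t Jt; rewrite complex_sumE xiE.
apply/(DeltaC0_components _ hJ _ a b) => // t Jt.
by rewrite xiE // complex_sumE.
Qed.
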